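(* Let $R$ be a commutative ring with identity, $M$ and $M'$ unital $R$-modules and $f:M\rightarrow M'$ an $R$-module homomorphism. (1) If $f$ is an epimorphism and $N$ is a semi $n$-submodule of $M$ containing $\mathrm{Ker}(f)$, then $f(N)$ is a semi $n$-submodule of $M'$. (2) If $f$ is an isomorphism and $N'$ is a semi $n$-submodule of $M'$, then $f^{-1}(N')$ is a semi $n$-submodule of $M$.
   Context: $\sqrt{0}$ is the nilradical of $R$; $Ann_R(m)=\{r\in R: rm=0\}$. A proper submodule $N$ of an $R$-module $M$ is called a semi $n$-submodule if whenever $r\in R$, $m\in M$ with $r^{2}m\in N$, $r\notin\sqrt{0}$ and $Ann_R(m)=0$, then $rm\in N$. *)

(* Defs.v *)
From mathcomp Require Import all_boot all_order all_algebra.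
From mathcomp Require Import boolp classical_sets functions.

Set Implicit Arguments.
Unset Strict Implicit.
Unset Printing Implicit Defensive.

Import GRing.Theory.
Local Open Scope classical_set_scope.
Local Open Scope ring_scope.

(* Rings are [comPzRingType]s, so the zero ring is allowed.  Submodules are
   Prop-valued sets; [in N] makes such a set a predicate for the algebra
   library. *)

Definition nilradical (R : comPzRingType) : set R :=
  [set r | exists n : nat, r ^+ n = 0].

Definition annihilator (R : comPzRingType) (M : lmodType R) (m : M) : set R :=
  [set r | r *: m = 0].

Definition submodule (R : comPzRingType) (M : lmodType R) (N : set M) : Prop :=
  GRing.submod_closed [in N].

Definition proper_submodule (R : comPzRingType) (M : lmodType R) (N : set M) :
    Prop :=
  submodule N /\ N <> setT.

Definition semi_n_submodule (R : comPzRingType) (M : lmodType R) (N : set M) :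
    Prop :=
  proper_submodule N /\
  forall (r : R) (m : M),
    N (r ^+ 2 *: m) -> ~ nilradical r -> annihilator m = [set 0] -> N (r *: m).

Definition kernel (R : comPzRingType) (M M' : lmodType R)
    (f : {linear M -> M'}) : set M :=
  f @^-1` [set 0].

(* Main.v *)
Require Import Defs.
From mathcomp Require Import all_boot all_order all_algebra.
From mathcomp Require Import boolp classical_sets functions.

Local Open Scope classical_set_scope.
Local Open Scope ring_scope.

Lemma submoduleP (R : comPzRingType) (M : lmodType R) (N : set M) :
  submodule N <->
  N 0 /\ forall (a : R) (u v : M), N u -> N v -> N (a *: u + v).
Proof.
split=> [[N0 Nlin]|[N0 Nlin]]; split=> [|a u v].
- exact: set_mem N0.
- by move=> Nu Nv; apply/set_mem/Nlin; exact: mem_set.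
- exact: mem_set.
- by move=> /set_mem Nu /set_mem Nv; apply/mem_set/Nlin.
Qed.

Lemma annihilator_linear (R : comPzRingType) (M M' : lmodType R)
    (f : {linear M -> M'}) (m : M) :
  annihilator m `<=` annihilator (f m).
Proof. by move=> r rm0; rewrite /annihilator/= -GRing.linearZ rm0 GRing.linear0. Qed.

Lemma annihilator_inj (R : comPzRingType) (M M' : lmodType R)
    (f : {linear M -> M'}) (m : M) :
  injective f -> annihilator (f m) = annihilator m.
Proof.
move=> f_inj; apply/seteqP; split; last exact: annihilator_linear.
by move=> r; rewrite /annihilator/= -GRing.linearZ -(GRing.linear0 f) => /f_inj.
Qed.

(** If [f n = f m] with [n] in [N], then [m = (m - n) + n], where [m - n] lies in the kernel and
    hence in [N]. *)
Lemma image_saturated (R : comPzRingType) (M M' : lmodType R)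
    (f : {linear M -> M'}) (N : set M) (m : M) :
  submodule N -> kernel f `<=` N -> (f @` N) (f m) -> N m.
Proof.
move=> /submoduleP[_ Nlin] kerN [n Nn fnm].
rewrite -(GRing.subrK n m) -[m - n]GRing.scale1r; apply: Nlin => //.
by apply: kerN; rewrite /kernel/= GRing.linearB fnm GRing.subrr.
Qed.

Arguments image_saturated {R M M' f N m}.

Lemma submodule_image (R : comPzRingType) (M M' : lmodType R)
    (f : {linear M -> M'}) (N : set M) :
  submodule N -> submodule (f @` N).
Proof.
move=> /submoduleP[N0 Nlin]; apply/submoduleP; split.
  by exists 0; rewrite ?GRing.linear0.
move=> a _ _ [u Nu <-] [v Nv <-].
by exists (a *: u + v); [exact: Nlin | rewrite GRing.linearP].
Qed.

Lemma submodule_preimage (R : comPzRingType) (M M' : lmodType R)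
    (f : {linear M -> M'}) (N' : set M') :
  submodule N' -> submodule (f @^-1` N').
Proof.
move=> /submoduleP[N0 Nlin]; apply/submoduleP; split=> [|a u v Nu Nv] /=.
  by rewrite GRing.linear0.
by rewrite GRing.linearP; exact: Nlin.
Qed.

Theorem proposition2 (R : comPzRingType) (M M' : lmodType R)
    (f : {linear M -> M'}) :
  (set_surj setT setT f ->
   forall N : set M, semi_n_submodule N -> kernel f `<=` N ->
     semi_n_submodule (f @` N))
  /\
  (bijective f ->
   forall N' : set M', semi_n_submodule N' -> semi_n_submodule (f @^-1` N')).
Proof.
split.
  move=> f_surj N [[subN N_proper] N_semi] kerN; split; first split.
  - exact: submodule_image.
  (* If the image were everything, each [f m] would lie in it, so saturation would put every [m] in
     [N]. *)
  - move=> fN_full; apply/N_proper/seteqP; split=> // m _.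
    by apply: (image_saturated subN kerN); rewrite fN_full.
  - move=> r m'; have [m _ <-] := f_surj m' I.
    rewrite -!GRing.linearZ => /(image_saturated subN kerN) Nr2m r_nnil annfm0.
    exists (r *: m) => //; apply: N_semi => //.
    (* The annihilator of [m] is squeezed between zero and that of [f m], which is zero by
       [annfm0]. *)
    apply/seteqP; split=> [s sm0|s ->].
      by rewrite -annfm0; exact: annihilator_linear.
    exact: GRing.scale0r.
move=> [g fK gK] N' [[subN' N'_proper] N'_semi]; split; first split.
- exact: submodule_preimage.
- move=> preN'_full; apply/N'_proper/seteqP; split=> // m' _.
  (* The inverse [g] supplies a preimage of the arbitrary [m'], so a full preimage would force [N']
     to be full. *)
  have : (f @^-1` N') (g m') by rewrite preN'_full.
  by rewrite /= gK.
- move=> r m /=; rewrite !GRing.linearZ => N'r2m r_nnil annm0.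
  by apply: N'_semi => //; rewrite annihilator_inj //; exact: can_inj fK.
Qed.
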